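(* Consider the stochastic process (case 2) describing transmission of photons through a sequence of $M\ge 1$ polarization sensitive elements rotated by angles $\vec\alpha=(\alpha_0,\dots,\alpha_{M-1})$, with $N_0\neq 0$ initial photons, as defined in the context; in particular, for every $i=0,\dots,M-1$ the density $\rho_{C,i}(\theta_i,\theta_{i+1},\alpha_i)$ does not depend on $\theta_i$ and is written $\rho_{\widetilde C,i}(\theta_{i+1},\alpha_i)$. Then for every $i\in(0,\dots,M-1)$, $$\frac{N_{i+1}(\vec\alpha)}{N_0}\,\rho_{S,i+1}(\theta_{i+1},\vec\alpha)=\rho_{\widetilde C,i}(\theta_{i+1},\alpha_i)\left[\int_{\theta_0}\rho_{S,0}(\theta_0,\vec\alpha)\,P_{T,0}(\theta_0,\alpha_0)\,\mathrm{d}\theta_0\right]\prod_{j=1}^{i}\left[\int_{\theta_j}\rho_{\widetilde C,j-1}(\theta_j,\alpha_{j-1})\,P_{T,j}(\theta_j,\alpha_j)\,\mathrm{d}\theta_j\right],$$ where the product $\prod_{j=1}^{i}[\dots]$ equals $1$ if $i=0$.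
   Context: Process ''case 2''. Photons pass successively through surfaces $\Sigma_0,\dots,\Sigma_M$; the $i$-th polarization sensitive element ($i=0,\dots,M-1$) lies between $\Sigma_i$ and $\Sigma_{i+1}$ and is rotated by a fixed (non-random) angle $\alpha_i$; $\vec\alpha=(\alpha_0,\dots,\alpha_{M-1})$. The state of a photon at $\Sigma_i$ is a random polarization angle $\theta_i$, ranging over a fixed interval of length $2\pi$ with Lebesgue measure $\mathrm{d}\theta_i$; $\int_{\theta_i}$ denotes integration over this interval. $N_0>0$ photons pass through $\Sigma_0$; different photons are independent. The data are: - $\rho_{S,0}(\theta_0,\vec\alpha)$: the probability density of $\theta_0$ (it does not depend on the element rotations). - $P_{T,i}(\theta_i,\alpha_i)\in[0,1]$, measurable: the conditional probability that a photon with polarization angle $\theta_i$ at $\Sigma_i$ is transmitted through the $i$-th element (otherwise it never reaches $\Sigma_{i+1},\dots,\Sigma_M$). - $\rho_{C,i}(\theta_i,\theta_{i+1},\alpha_i)\ge 0$, jointly measurable in $(\theta_i,\theta_{i+1})$, with $\int_{\theta_{i+1}}\rho_{C,i}(\theta_i,\theta_{i+1},\alpha_i)\,\mathrm{d}\theta_{i+1}=1$ for all $\theta_i$: the conditional probability density of the outgoing polarization angle $\theta_{i+1}$, given the incoming angle $\theta_i$ and given that the photon was transmitted through the $i$-th element. In case 2 it is assumed that $\rho_{C,i}$ does not depend on $\theta_i$: $\rho_{C,i}(\theta_i,\theta_{i+1},\alpha_i)=\rho_{\widetilde C,i}(\theta_{i+1},\alpha_i)$ for all $i=0,\dots,M-1$.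 Memoryless (Markov) property: transmission through the $i$-th element and the resulting angle depend on the past only through $\theta_i$. Derived quantities: $N_i(\vec\alpha)$ is the (expected) number of photons which pass through $\Sigma_i$, i.e. $N_0$ times the probability that a photon reaches $\Sigma_i$ (so $N_0(\vec\alpha)=N_0$); $\rho_{S,i}(\theta_i,\vec\alpha)$ is the probability density of the polarization angle at $\Sigma_i$ conditioned on the photon reaching $\Sigma_i$ (both depend on $\vec\alpha$ at most through $\alpha_0,\dots,\alpha_{i-1}$). If $N_i(\vec\alpha)=0$, the product $N_i(\vec\alpha)\rho_{S,i}(\theta_i,\vec\alpha)$ is understood to be $0$. Identities between densities are understood almost everywhere. *)

(* Defs.v *)
From HB Require Import structures.
From mathcomp Require Import all_boot all_order all_algebra.
From mathcomp Require Import all_classical all_reals all_analysis.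
From mathcomp Require Import measurable_realfun.

Set Implicit Arguments.
Unset Strict Implicit.
Unset Printing Implicit Defensive.

Import Order.TTheory GRing.Theory Num.Theory.
Import numFieldNormedType.Exports.

Local Open Scope classical_set_scope.
Local Open Scope ring_scope.

(* Conventions.  [J] is the fixed range of polarization angles.  Surfaces and
   elements are indexed by nat: only surfaces [i <= M] and elements [i < M] are
   constrained, and only [alpha 0, ..., alpha M.-1] matter.  A photon [n] has
   two families: [reach n i], the event that it passes through surface [i], and
   [theta n i], its polarization angle there.  [theta n i] is a total function,
   but its values outside [reach n i] carry no meaning and are never used. *)

Section Elements.
Context {R : realType}.

(* Arguments are in the order (theta_i, alpha_i) for [PT i] and
   (theta_i, theta_(i+1), alpha_i) for [rhoC i]. *)
Record element_data (M : nat) (J : set R) (alpha : nat -> R)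
    (PT : nat -> R -> R -> R) (rhoC : nat -> R -> R -> R -> R) : Prop := {
  transmission_meas : forall i, (i < M)%N ->
    measurable_fun J (fun x => PT i x (alpha i));
  transmission_01 : forall i x, (i < M)%N -> J x -> 0 <= PT i x (alpha i) <= 1;
  outgoing_meas : forall i, (i < M)%N ->
    measurable_fun (J `*` J) (fun p : R * R => rhoC i p.1 p.2 (alpha i));
  outgoing_ge0 : forall i x y, (i < M)%N -> J x -> J y ->
    0 <= rhoC i x y (alpha i);
  outgoing_total : forall i x, (i < M)%N -> J x ->
    (\int[lebesgue_measure]_(y in J) (rhoC i x y (alpha i))%:E = 1)%E
}.

Definition case2 (M : nat) (J : set R) (alpha : nat -> R)
    (rhoC : nat -> R -> R -> R -> R) (rhoCt : nat -> R -> R -> R) : Prop :=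
  forall i x y, (i < M)%N -> J x -> J y ->
    rhoC i x y (alpha i) = rhoCt i y (alpha i).

End Elements.

Section Process.
Context {d : measure_display} {Omega : measurableType d} {R : realType}.
Variable P : probability Omega R.

(* [f] is a version of the conditional probability of [E] given the
   information [F] and the occurrence of [D]. *)
Definition is_cond_prob (F : set (set Omega)) (D E : set Omega)
    (f : Omega -> \bar R) : Prop :=
  forall A, F A -> (P (A `&` D `&` E) = \int[P]_(w in A `&` D) f w)%E.

(* [rho] is a probability density on [J] of the random angle [X] conditioned on
   the event [D]; nothing is required when [D] is negligible. *)
Definition is_cond_density (J : set R) (D : set Omega) (X : Omega -> R)
    (rho : R -> R) : Prop :=
  P D != 0%E ->
  [/\ measurable_fun J rho,
      forall x, J x -> 0 <= rho x &
      forall B : set R, measurable B ->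
        (fine (P (D `&` X @^-1` B)) / fine (P D))%:E =
        (\int[lebesgue_measure]_(x in B `&` J) (rho x)%:E)%E ].

(* The sigma-algebra of what happened to one photon up to surface [i]; taking
   [B := setT] shows that it contains the events [reach k]. *)
Definition history (reach : nat -> set Omega) (theta : nat -> Omega -> R)
    (i : nat) : set (set Omega) :=
  <<s [set A | exists k (B : set R), [/\ (k <= i)%N, measurable B &
                 A = reach k `&` theta k @^-1` B]] >>.

Definition independent_photons (M N0 : nat) (reach : 'I_N0 -> nat -> set Omega)
    (theta : 'I_N0 -> nat -> Omega -> R) : Prop :=
  forall A : 'I_N0 -> set Omega,
    (forall n, history (reach n) (theta n) M (A n)) ->
    P (\bigcap_(n in [set: 'I_N0]) A n) = (\prod_(n < N0) P (A n))%E.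

(* The last two fields combine the meaning of [PT] and [rhoC] as conditional
   laws with the Markov property: conditioning on the whole history of the
   photon gives a function of its current angle only. *)
Record photon_process (M N0 : nat) (J : set R) (alpha : nat -> R)
    (rhoS0 : R -> R) (PT : nat -> R -> R -> R)
    (rhoC : nat -> R -> R -> R -> R)
    (reach : 'I_N0 -> nat -> set Omega)
    (theta : 'I_N0 -> nat -> Omega -> R) : Prop := {
  reach_meas : forall n i, (i <= M)%N -> measurable (reach n i);
  angle_meas : forall n i, (i <= M)%N -> measurable_fun setT (theta n i);
  angle_range : forall n i w, (i <= M)%N -> reach n i w -> J (theta n i w);
  photons_indep : independent_photons M reach theta;
  reach_start : forall n, reach n 0%N = setT;
  reach_next : forall n i, (i < M)%N -> reach n i.+1 `<=` reach n i;
  source_density : forall n,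
    is_cond_density J (reach n 0%N) (theta n 0%N) rhoS0;
  markov_transmission : forall n i, (i < M)%N ->
    is_cond_prob (history (reach n) (theta n) i) (reach n i) (reach n i.+1)
      (fun w => (PT i (theta n i w) (alpha i))%:E);
  markov_outgoing : forall n i (B : set R), (i < M)%N -> measurable B ->
    is_cond_prob (history (reach n) (theta n) i) (reach n i.+1)
      (theta n i.+1 @^-1` B)
      (fun w => \int[lebesgue_measure]_(y in B `&` J)
                  (rhoC i (theta n i w) y (alpha i))%:E)%E
}.

Definition expected_count (N0 : nat) (reach : 'I_N0 -> nat -> set Omega)
    (i : nat) : R :=
  fine ('E_P[fun w => (\sum_(n < N0) \1_(reach n i) w)%R])%E.

(* [rhoS i] is the density of the angle at surface [i] of a photon conditioned
   on reaching it; it is the same for all photons. *)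
Definition is_state_density (M N0 : nat) (J : set R)
    (reach : 'I_N0 -> nat -> set Omega) (theta : 'I_N0 -> nat -> Omega -> R)
    (rhoS : nat -> R -> R) : Prop :=
  forall n i, (i <= M)%N -> is_cond_density J (reach n i) (theta n i) (rhoS i).

End Process.

(* Main.v *)
(* In case 2 the angle at surface i+1 of a photon reaching it is independent of
   the past, so conditioned on reaching it, this angle has density rhoCt i,
   which by uniqueness of densities is rhoS i.+1 almost everywhere.  Integrating
   the transmission probability of element i against the law of the incoming
   angle shows that each passage multiplies the probability of being still
   present by one of the integrals of the formula.  When a photon reaches
   surface i+1 with probability zero, this product vanishes too. *)
Require Import Defs.
From HB Require Import structures.
From mathcomp Require Import all_boot all_order all_algebra.
From mathcomp Require Import all_classical all_reals all_analysis.
From mathcomp Require Import measurable_realfun.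
Import Order.TTheory GRing.Theory Num.Theory.
Import numFieldNormedType.Exports.
Local Open Scope classical_set_scope.
Local Open Scope ring_scope.

(** * Integrating a function of a random angle against its density *)

Section Density.
Import HBNNSimple.

(** Both sides split into a finite sum over the values of [s], and on each level set the claim is
    the hypothesis on [g]. Here [g] describes [X] on the event [D] without normalisation: its
    integral over [J] is [mu D]. *)
Lemma nnsfun_integral_density {d1 d2 : measure_display}
    {S : measurableType d1} {T : measurableType d2} {R : realType}
    (mu : {measure set S -> \bar R}) (nu : {measure set T -> \bar R})
    (D : set S) (J : set T) (X : S -> T) (g : T -> R) (s : {nnsfun T >-> R}) :
  measurable D -> measurable J -> measurable_fun setT X ->
  measurable_fun J g -> (forall x, J x -> 0 <= g x) ->
  (forall B, measurable B ->
    mu (D `&` X @^-1` B) = \int[nu]_(x in B `&` J) (g x)%:E)%E ->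
  (\int[mu]_(w in D) (s (X w))%:E = \int[nu]_(x in J) ((s x)%:E * (g x)%:E))%E.
Proof.
move=> mD mJ mX mg g0 law.
have mXB B : measurable B -> measurable (X @^-1` B).
  by move=> mB; rewrite -[_ @^-1` _]setTI; exact: mX.
have ms r : measurable (s @^-1` [set r]) by exact: measurable_funPTI.
under [LHS]eq_integral do rewrite fimfunE -fsumEFin//.
rewrite [LHS]ge0_integral_fsum//; last 2 first.
- move=> r; apply/measurable_EFinP/measurable_funTS.
  apply: measurable_funM => //.
  by apply: (measurableT_comp (measurable_indic (ms r))).
- by move=> r x _; rewrite EFinM nnfun_muleindic_ge0.
under [RHS]eq_integral.
  move=> x xJ; rewrite fimfunE -fsumEFin// muleC ge0_mule_fsumr; last first.
    by move=> r; rewrite EFinM nnfun_muleindic_ge0.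
  over.
have mgE : measurable_fun J (EFin \o g) by exact/measurable_EFinP.
rewrite [RHS]ge0_integral_fsum//; last 2 first.
- move=> r; apply: emeasurable_funM => //.
  by apply/measurable_EFinP/measurable_funTS; exact: measurable_funM.
- by move=> r x Jx; rewrite EFinM mule_ge0 ?nnfun_muleindic_ge0// lee_fin g0.
(* Only values taken by [s] occur, so [r] is nonnegative and may be pulled out of the integrals. *)
apply: eq_fsbigr => r; rewrite inE => -[x _ sx].
have r0 : 0 <= r by rewrite -sx.
transitivity (r%:E * mu (D `&` X @^-1` (s @^-1` [set r])))%E.
  rewrite setIC -integral_indic//; last exact: mXB.
  rewrite -ge0_integralZl_EFin//.
  by apply/measurable_EFinP/measurable_indic/mXB.
rewrite law// integral_mkcondl -ge0_integralZl_EFin//; last 2 first.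
- by move=> y Jy; rewrite patchE; case: ifPn => // _; rewrite lee_fin g0.
- apply/(measurable_restrict (EFin \o g) (ms r) mJ).
  by apply: measurable_funS mgE => //; exact: subIsetl.
apply: eq_integral => y _; rewrite patchE indicE.
by case: ifPn => _ /=; rewrite ?(mulr1,mulr0,mule0)// muleC.
Qed.

(** Monotone convergence on both sides, along simple functions increasing to [f]. They converge on
    [J] only, hence the requirement that [X] maps [D] into [J]. *)
Lemma ge0_integral_density {d1 d2 : measure_display}
    {S : measurableType d1} {T : measurableType d2} {R : realType}
    (mu : {measure set S -> \bar R}) (nu : {measure set T -> \bar R})
    (D : set S) (J : set T) (X : S -> T) (g : T -> R) (f : T -> \bar R) :
  measurable D -> measurable J -> measurable_fun setT X ->
  (forall w, D w -> J (X w)) ->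
  measurable_fun J g -> (forall x, J x -> 0 <= g x) ->
  (forall B, measurable B ->
    mu (D `&` X @^-1` B) = \int[nu]_(x in B `&` J) (g x)%:E)%E ->
  measurable_fun J f -> (forall x, J x -> 0 <= f x)%E ->
  (\int[mu]_(w in D) f (X w) = \int[nu]_(x in J) (f x * (g x)%:E))%E.
Proof.
move=> mD mJ mX DJ mg g0 law mf f0.
pose f_ := nnsfun_approx mJ mf.
have cvf x : J x -> (EFin \o f_^~ x) @ \oo --> f x.
  by move=> Jx; exact: cvg_nnsfun_approx.
transitivity (limn (fun n => \int[mu]_(w in D) (f_ n (X w))%:E))%E.
  rewrite -monotone_convergence//=.
  - by apply: eq_integral => w /[!inE] Dw; apply/esym/cvg_lim => //; exact/cvf/DJ.
  - by move=> n; apply/measurable_EFinP/measurable_funTS/measurableT_comp.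
  - by move=> n w _; rewrite lee_fin.
  - by move=> w _ m n mn; rewrite lee_fin; exact/lefP/nd_nnsfun_approx.
transitivity (limn (fun n => \int[nu]_(x in J) ((f_ n x)%:E * (g x)%:E)))%E.
  by apply: congr_lim; apply/funext => n; exact: nnsfun_integral_density.
rewrite -monotone_convergence//=.
- apply: eq_integral => x /[!inE] Jx; apply/cvg_lim => //.
  by apply: cvgeZr => //; exact: cvf.
- move=> n; apply: emeasurable_funM; last exact/measurable_EFinP.
  exact/measurable_EFinP/measurable_funTS.
- by move=> n x Jx; rewrite -EFinM lee_fin mulr_ge0// g0.
- move=> x Jx m n mn; rewrite -!EFinM lee_fin ler_wpM2r ?g0//.
  exact/lefP/nd_nnsfun_approx.
Qed.

End Density.

(** Infinite [x] is covered because [fine] sends both infinities to 0. A real factor can thus cross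
    [fine] without a proof of finiteness. *)
Lemma fine_EFinMl {R : realType} (r : R) (x : \bar R) :
  fine (r%:E * x)%E = r * fine x.
Proof.
have [->|r0] := eqVneq r 0; first by rewrite mul0e mul0r.
by case: x => [x| |] //=; rewrite (mulr0, mulry, mulrNy) //
  /Num.sg (negbTE r0); case: ifPn => _; rewrite ?mul1e ?mulN1e /= mulr0.
Qed.

(** * Transmission probabilities and angle laws of a photon in case 2 *)

Section Photon.
Context {R : realType} {d : measure_display} {Omega : measurableType d}.
Context {P : probability Omega R} {M N0 : nat} {J : set R} {alpha : nat -> R}.
Context {rhoS0 : R -> R} {PT : nat -> R -> R -> R}.
Context {rhoC : nat -> R -> R -> R -> R}.
Context {reach : 'I_N0 -> nat -> set Omega} {theta : 'I_N0 -> nat -> Omega -> R}.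
Implicit Types (n : 'I_N0) (i : nat).

(** Taking the sure event as the past turns the Markov fields into formulas for plain
    probabilities. *)
Lemma history_setT n i :
  photon_process P M J alpha rhoS0 PT rhoC reach theta ->
  history (reach n) (theta n) i setT.
Proof.
move=> hp; apply: sub_sigma_algebra; exists 0%N, setT; split => //.
by rewrite (reach_start hp) preimage_setT setIT.
Qed.

Lemma reach_next_prob n i :
  photon_process P M J alpha rhoS0 PT rhoC reach theta -> (i < M)%N ->
  P (reach n i.+1) = (\int[P]_(w in reach n i) (PT i (theta n i w) (alpha i))%:E)%E.
Proof.
move=> hp iM; have := markov_transmission hp iM (history_setT n i hp).
by rewrite !setTI setIidr//; exact: (reach_next hp iM (n := n)).
Qed.

(** In case 2 the conditional law of the outgoing angle does not vary with the incoming one, so its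
    integral over [reach n i.+1] is that of a constant. *)
Lemma case2_law {rhoCt : nat -> R -> R -> R} n i (B : set R) :
  measurable J -> case2 M J alpha rhoC rhoCt ->
  photon_process P M J alpha rhoS0 PT rhoC reach theta ->
  (i < M)%N -> measurable B ->
  (P (reach n i.+1 `&` theta n i.+1 @^-1` B) =
   \int[lebesgue_measure]_(y in B `&` J) (rhoCt i y (alpha i))%:E
   * P (reach n i.+1))%E.
Proof.
move=> mJ h2 hp iM mB.
have := markov_outgoing hp iM mB (history_setT n i hp).
rewrite !setTI => ->; rewrite -integral_cst; last exact: (reach_meas hp n iM).
apply: eq_integral => w /[!inE] rw; apply: eq_integral => y /[!inE] -[_ Jy].
(* A photon at surface [i.+1] also passed surface [i], so its incoming angle lies in [J], where case
   2 applies. *)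
congr _%:E; apply: h2 => //; apply: (angle_range hp (ltnW iM)).
exact: (reach_next hp iM).
Qed.

(** Fixing any incoming angle [x] in [J] identifies [rhoCt i] on [J] with the section of [rhoC i] at
    [x], which carries the three properties. *)
Lemma case2_density {rhoCt : nat -> R -> R -> R} i :
  J !=set0 -> measurable J ->
  element_data M J alpha PT rhoC -> case2 M J alpha rhoC rhoCt ->
  (i < M)%N ->
  [/\ measurable_fun J (fun y => rhoCt i y (alpha i)),
      forall y, J y -> 0 <= rhoCt i y (alpha i) &
      (\int[lebesgue_measure]_(y in J) (rhoCt i y (alpha i))%:E = 1)%E].
Proof.
move=> [x Jx] mJ he h2 iM; split.
- have -> : measurable_fun J (fun y => rhoCt i y (alpha i)) =
            measurable_fun J (fun y => rhoC i x y (alpha i)).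
    apply/propext; split; apply: eq_measurable_fun => y /[!inE] Jy;
      by rewrite (h2 i x y).
  apply: (@measurable_comp _ _ _ _ _ _ (J `*` J)
    (fun p : R * R => rhoC i p.1 p.2 (alpha i)) J (pair x)).
  + exact: measurableX.
  + by move=> _ [y Jy <-].
  + exact: (outgoing_meas he iM).
  + exact: measurable_funTS.
- by move=> y Jy; rewrite -(h2 i x y)// (outgoing_ge0 he).
- rewrite -(outgoing_total he iM Jx); apply: eq_integral => y /[!inE] Jy.
  by rewrite (h2 i x y).
Qed.

(** Stated for an unnormalised density [g] of total mass [P (reach n i)], which avoids dividing by a
    probability that may vanish. *)
Lemma reach_next_density {g : R -> R} n i :
  measurable J -> element_data M J alpha PT rhoC ->
  photon_process P M J alpha rhoS0 PT rhoC reach theta -> (i < M)%N ->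
  measurable_fun J g -> (forall x, J x -> 0 <= g x) ->
  (forall B, measurable B -> P (reach n i `&` theta n i @^-1` B) =
    \int[lebesgue_measure]_(x in B `&` J) (g x)%:E)%E ->
  P (reach n i.+1) =
  (\int[lebesgue_measure]_(x in J) ((PT i x (alpha i))%:E * (g x)%:E))%E.
Proof.
move=> mJ he hp iM mg g0 law; rewrite (reach_next_prob n i hp iM).
apply: (@ge0_integral_density _ _ _ _ _ P lebesgue_measure _ _ _ g
  (fun x => (PT i x (alpha i))%:E)) => //.
- exact: (reach_meas hp n (ltnW iM)).
- exact: (angle_meas hp n (ltnW iM)).
- by move=> w; apply: (angle_range hp (ltnW iM)).
- by apply/measurable_EFinP; exact: (transmission_meas he iM).
- by move=> x Jx; rewrite lee_fin; case/andP: (transmission_01 he iM Jx).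
Qed.

Lemma reach1_prob n :
  measurable J -> element_data M J alpha PT rhoC ->
  photon_process P M J alpha rhoS0 PT rhoC reach theta -> (0 < M)%N ->
  fine (P (reach n 1%N)) =
  \int[lebesgue_measure]_(x in J) (rhoS0 x * PT 0%N x (alpha 0%N)).
Proof.
move=> mJ he hp M0; have := source_density hp (n := n).
rewrite /is_cond_density (reach_start hp n) probability_setT => /(_ (oner_neq0 _)) -[mg g0 law].
rewrite (reach_next_density n 0%N mJ he hp M0 mg g0) => [|B mB].
  by rewrite /Rintegral; congr fine; apply: eq_integral => x _; rewrite -EFinM mulrC.
(* Surface 0 is reached with probability 1, so [rhoS0] is its own unnormalised density. *)
rewrite -law// divr1 fineK ?(reach_start hp)// fin_num_measure//.
rewrite setTI -[_ @^-1` _]setTI.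
exact: (angle_meas hp n (leq0n _)).
Qed.

Lemma reach_succ_prob {rhoCt : nat -> R -> R -> R} n i :
  J !=set0 -> measurable J ->
  element_data M J alpha PT rhoC -> case2 M J alpha rhoC rhoCt ->
  photon_process P M J alpha rhoS0 PT rhoC reach theta -> (i.+1 < M)%N ->
  fine (P (reach n i.+2)) = fine (P (reach n i.+1)) *
  \int[lebesgue_measure]_(x in J)
    (rhoCt i x (alpha i) * PT i.+1 x (alpha i.+1)).
Proof.
move=> J0 mJ he h2 hp iM.
have iM' : (i < M)%N by exact: ltnW.
have [mg g0 _] := case2_density i J0 mJ he h2 iM'.
have mr : measurable (reach n i.+1) by exact: (reach_meas hp n iM').
set p := fine (P (reach n i.+1)).
have pE : P (reach n i.+1) = p%:E by rewrite fineK// fin_num_measure.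
have p0 : 0 <= p by exact: fine_ge0.
(* By [case2_law] this is the unnormalised density of the angle at surface [i.+1]; the factor [p]
   then leaves the integral. *)
pose g x := p * rhoCt i x (alpha i).
have mPT := transmission_meas he iM.
rewrite (@reach_next_density g n i.+1 mJ he hp iM); last 3 first.
- exact: measurable_funM.
- by move=> x Jx; rewrite mulr_ge0// g0.
- move=> B mB; rewrite (case2_law n i B mJ h2 hp iM' mB) pE muleC.
  rewrite -ge0_integralZl_EFin//.
  + exact: measurableI.
  + by move=> x [_ Jx]; rewrite lee_fin g0.
  + apply/measurable_EFinP; apply: measurable_funS mg => //; exact: subIsetr.
rewrite /Rintegral -fine_EFinMl; congr fine.
rewrite -ge0_integralZl_EFin//.
- by apply: eq_integral => x _; rewrite -!EFinM /g mulrC -mulrA.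
- move=> x Jx; rewrite lee_fin mulr_ge0 ?g0//.
  by case/andP: (transmission_01 he iM Jx).
- by apply/measurable_EFinP; exact: measurable_funM.
Qed.

Lemma reach_prob {rhoCt : nat -> R -> R -> R} n i :
  J !=set0 -> measurable J ->
  element_data M J alpha PT rhoC -> case2 M J alpha rhoC rhoCt ->
  photon_process P M J alpha rhoS0 PT rhoC reach theta -> (i < M)%N ->
  fine (P (reach n i.+1)) =
  (\int[lebesgue_measure]_(x in J) (rhoS0 x * PT 0%N x (alpha 0%N)))
  * \prod_(1 <= j < i.+1)
      (\int[lebesgue_measure]_(x in J)
         (rhoCt j.-1 x (alpha j.-1) * PT j x (alpha j))).
Proof.
move=> J0 mJ he h2 hp; elim: i => [|i IH] iM.
  by rewrite big_geq// mulr1; exact: reach1_prob.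
rewrite (reach_succ_prob n i J0 mJ he h2 hp iM) IH ?(ltnW iM)//.
by rewrite [in RHS]big_nat_recr//= mulrA.
Qed.

(** Both functions have the same integral over every measurable subset of [J], and [rhoCt i] is
    integrable there with total mass 1, so they agree almost everywhere. *)
Lemma case2_state_density_ae {rhoCt : nat -> R -> R -> R} {rho : R -> R} n i :
  J !=set0 -> measurable J ->
  element_data M J alpha PT rhoC -> case2 M J alpha rhoC rhoCt ->
  photon_process P M J alpha rhoS0 PT rhoC reach theta -> (i < M)%N ->
  P (reach n i.+1) != 0%E ->
  is_cond_density P J (reach n i.+1) (theta n i.+1) rho ->
  {ae @lebesgue_measure R, forall y, J y -> rho y = rhoCt i y (alpha i)}.
Proof.
move=> J0 mJ he h2 hp iM Pn0 /(_ Pn0)[mrho rho0 law].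
have [mg g0 g1] := case2_density i J0 mJ he h2 iM.
have Pfin : P (reach n i.+1) \is a fin_num.
  by rewrite fin_num_measure//; exact: (reach_meas hp n iM).
suff : ae_eq lebesgue_measure J (fun y => (rhoCt i y (alpha i))%:E)
         (fun y => (rho y)%:E).
  by apply: filterS => y /[apply] -[].
apply: integral_ae_eq => //.
- apply/integrableP; split; first exact/measurable_EFinP.
  under eq_integral => y /[!inE] Jy do rewrite gee0_abs ?lee_fin ?g0//.
  by rewrite g1 ltry.
- exact/measurable_EFinP.
move=> E EJ mE; have := law _ mE; rewrite (case2_law n i E mJ h2 hp iM mE).
rewrite (setIidl EJ) => <-; rewrite -[in RHS](fineK Pfin) muleC fine_EFinMl.
rewrite mulrAC divff ?mul1r; last by rewrite fine_eq0.
(* The integral over [E] is finite, being at most the total mass 1 over [J]. *)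
rewrite fineK// ge0_fin_numE; last first.
  by apply: integral_ge0 => y /EJ Jy; rewrite lee_fin g0.
apply: le_lt_trans (ltry 1); rewrite -g1; apply: ge0_subset_integral => //.
exact/measurable_EFinP.
Qed.

(** Linearity of expectation, applied to the indicators of the events [reach n i]. *)
Lemma expected_count_sum i :
  photon_process P M J alpha rhoS0 PT rhoC reach theta -> (i <= M)%N ->
  expected_count P reach i = \sum_(n < N0) fine (P (reach n i)).
Proof.
move=> hp iM; rewrite /expected_count unlock.
under eq_integral do rewrite -sumEFin.
rewrite ge0_integral_sum//; last first.
  move=> n; apply/measurable_EFinP/measurable_indic; exact: (reach_meas hp n iM).
rewrite (eq_bigr (fun n => (fine (P (reach n i)))%:E)) ?sumEFin// => n _.
have mr := reach_meas hp n iM.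
by rewrite integral_indic ?setIT// fineK// fin_num_measure.
Qed.

End Photon.

(** * From one photon to the expected counts *)

Theorem mainTheorem6 (R : realType) (d : measure_display)
    (Omega : measurableType d) (P : probability Omega R)
    (M N0 : nat) (J : interval R) (alpha : nat -> R)
    (rhoS0 : R -> R) (PT : nat -> R -> R -> R)
    (rhoC : nat -> R -> R -> R -> R) (rhoCt : nat -> R -> R -> R)
    (reach : 'I_N0 -> nat -> set Omega) (theta : 'I_N0 -> nat -> Omega -> R)
    (rhoS : nat -> R -> R)
    (hM : (1 <= M)%N) (hN0 : N0 <> 0%N)
    (hJ : lebesgue_measure [set` J] = (2 * pi)%:E)
    (helements : element_data M [set` J] alpha PT rhoC)
    (hcase2 : case2 M [set` J] alpha rhoC rhoCt)
    (hprocess : photon_process P M [set` J] alpha rhoS0 PT rhoC reach theta)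
    (hrhoS : is_state_density P M [set` J] reach theta rhoS) :
  forall i : nat, (i < M)%N ->
    {ae @lebesgue_measure R, forall y, y \in J ->
      expected_count P reach i.+1 / N0%:R * rhoS i.+1 y =
      rhoCt i y (alpha i)
      * (\int[lebesgue_measure]_(x in [set` J])
           (rhoS0 x * PT 0%N x (alpha 0%N)))
      * \prod_(1 <= j < i.+1)
          (\int[lebesgue_measure]_(x in [set` J])
             (rhoCt j.-1 x (alpha j.-1) * PT j x (alpha j)))}.
Proof.
move=> i iM.
have mJ : measurable [set` J] by exact: measurable_itv.
(* The length of [J] is [2 * pi], which is nonzero, whereas the empty set has measure 0. *)
have J0 : [set` J] !=set0.
  apply/set0P/eqP => JE; move: hJ; rewrite JE measure0 => -[].
  by apply/eqP; rewrite eq_sym mulf_neq0// gt_eqF// pi_gt0.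
(* A representative photon: the value given by [reachE] is the same for all, so the mean over the
   photons is its own probability. *)
have n0 : 'I_N0 by case: N0 hN0 {reach theta hprocess hrhoS} => // k _; exact: ord0.
have reachE n := reach_prob n i J0 mJ helements hcase2 hprocess iM.
have countE : expected_count P reach i.+1 / N0%:R = fine (P (reach n0 i.+1)).
  rewrite (expected_count_sum i.+1 hprocess iM).
  under eq_bigr do rewrite reachE -(reachE n0).
  by rewrite sumr_const card_ord -[X in X / _]mulr_natr mulfK// pnatr_eq0; exact/eqP.
(* If this probability is 0, [rhoS i.+1] is unconstrained, but its coefficient on the left vanishes,
   and so does the product on the right by [reachE]. *)
have [P0|Pn0] := eqVneq (P (reach n0 i.+1)) 0%E.
  by apply: aeW => y _; rewrite countE -mulrA -(reachE n0) P0 mul0r mulr0.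
have := case2_state_density_ae n0 i J0 mJ helements hcase2 hprocess iM Pn0
  (hrhoS n0 i.+1 iM).
apply: (@filterS _ _ (ae_filter_ringOfSetsType lebesgue_measure)) => y rhoE Jy.
by rewrite countE rhoE// (reachE n0) -mulrA mulrC.
Qed.
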